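(* For all $n\in\mathbb{N}$: $\mathrm{BWT}_n<_W\mathrm{BWT}_{n+1}<_W\mathrm{BWT}_\mathbb{N}<_W\mathrm{BWT}_\mathbb{R}$.
   Context: A representation of a set $X$ is a surjective partial function $\delta:\subseteq\mathbb{N}^\mathbb{N}\to X$. For $f:\subseteq(X,\delta_X)\rightrightarrows(Y,\delta_Y)$ a realizer is a single-valued partial $F$ on Baire space with $\delta_Y(F(p))\in f(\delta_X(p))$ for all $p\in\mathrm{dom}(f\circ\delta_X)$ ($F\vdash f$). With $\langle p,q\rangle(2n)=p(n)$, $\langle p,q\rangle(2n+1)=q(n)$: $f\le_W g$ iff there are computable partial $H,K$ on Baire space such that $p\mapsto H\langle p,G(K(p))\rangle$ realizes $f$ for every $G\vdash g$; $f<_Wg$ means $f\le_Wg$ and $g\not\le_W f$. A natural number $n$ is identified with the set $\{0,\ldots,n-1\}$. For a computable metric space $X$ (represented by its Cauchy representation), $\mathrm{BWT}_X:\subseteq X^\mathbb{N}\rightrightarrows X$ maps $(x_k)$ to the set of its cluster points, with domain the sequences whose range has compact closure; $X^\mathbb{N}$ is represented by $\langle p_0,p_1,\ldots\rangle\mapsto(\delta_X(p_i))_i$ with $\langle p_0,p_1,\ldots\rangle(\langle i,j\rangle)=p_i(j)$. Here $n=\{0,\ldots,n-1\}$ and $\mathbb{N}$ carry the discrete metric and are represented by $p\mapsto p(0)$ (so $\mathrm{BWT}_n$ maps a sequence in $\{0,\ldots,n-1\}$ to any value occurring infinitely often, $\mathrm{BWT}_0$ being nowhere defined, and $\mathrm{BWT}_\mathbb{N}$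 does the same for sequences of naturals with bounded range), and $\mathbb{R}$ carries the Euclidean metric (so $\mathrm{BWT}_\mathbb{R}$ maps a bounded real sequence to any of its cluster points). *)

(* Defs.v *)
From HB Require Import structures.
From mathcomp Require Import all_boot all_order all_algebra.
From mathcomp Require Import all_classical all_reals all_analysis.
From mathcomp Require Import zify lra.

Set Implicit Arguments.
Unset Strict Implicit.
Unset Printing Implicit Defensive.

Import Order.TTheory GRing.Theory Num.Theory.
Import numFieldNormedType.Exports.

Local Open Scope classical_set_scope.
Local Open Scope ring_scope.

Definition baire : Type := nat -> nat.

(* Cantor's pairing <i, j> = (i + j)(i + j + 1)/2 + j and its inverse; [unpair]
   walks along the antidiagonals (0,0), (1,0), (0,1), (2,0), (1,1), ... *)
Definition cpair (i j : nat) : nat := (((i + j) * (i + j).+1)./2 + j)%N.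

Fixpoint unpair (n : nat) : nat * nat :=
  if n is m.+1 then
    let: (i, j) := unpair m in if i is i'.+1 then (i', j.+1) else (j.+1, 0%N)
  else (0%N, 0%N).

Lemma half_triangle s : ((s.+1 * s.+2)./2 = (s * s.+1)./2 + s.+1)%N.
Proof.
have -> : (s.+1 * s.+2 = s * s.+1 + s.+1.*2)%N by nia.
by rewrite halfD odd_double andbF doubleK add0n.
Qed.

Lemma unpairS n : unpair n.+1 =
  let: (i, j) := unpair n in if i is i'.+1 then (i', j.+1) else (j.+1, 0%N).
Proof. by []. Qed.

Lemma unpairK n : cpair (unpair n).1 (unpair n).2 = n.
Proof.
elim: n => [//|n IHn] /=; case: (unpair n) IHn => -[|i] j /= <-.
  by rewrite /cpair !(addn0, add0n) half_triangle addnS.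
by rewrite /cpair addSnnS addnS.
Qed.

Lemma cpairK i j : unpair (cpair i j) = (i, j).
Proof.
suff H s : forall i j, (i + j = s)%N -> unpair (cpair i j) = (i, j) by exact: H.
elim: s => [[|?] [|?]//|s IHs] {}i {}j.
elim: j i => [i|j IHj i].
  rewrite addn0 => ->; suff -> : cpair s.+1 0 = (cpair 0 s).+1 by rewrite unpairS IHs.
  by rewrite /cpair !(addn0, add0n) half_triangle addnS.
move=> ijs; suff -> : cpair i j.+1 = (cpair i.+1 j).+1.
  by rewrite unpairS IHj// addSnnS.
by rewrite /cpair addSnnS addnS.
Qed.

(* Kleene's partial recursive functions relative to an oracle p : N -> N,
   written with unary functions on numbers coding pairs. *)
Inductive code : Type :=
| Zero | Succ | Fst | Snd | Oracle
| Pair of code & code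
| Comp of code & code
| Prec of code & code
| Mu of code.

(* [eval p c x y]: the machine c with oracle p halts on input x with output y. *)
Fixpoint eval (p : baire) (c : code) : nat -> nat -> Prop :=
  match c with
  | Zero => fun x y => y = 0%N
  | Succ => fun x y => y = x.+1
  | Fst => fun x y => y = (unpair x).1
  | Snd => fun x y => y = (unpair x).2
  | Oracle => fun x y => y = p x
  | Pair f g => fun x y =>
      exists a b, [/\ eval p f x a, eval p g x b & y = cpair a b]
  | Comp f g => fun x y => exists2 z, eval p g x z & eval p f z y
  (* on <a, n>: h(a, 0) = f(a) and h(a, k + 1) = g(a, k, h(a, k)) *)
  | Prec f g => fun x y =>
      let: (a, n) := unpair x in
      exists r : nat -> nat,
        [/\ eval p f a (r 0%N),
            forall k, (k < n)%N ->
              eval p g (cpair a (cpair k (r k))) (r k.+1)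
          & y = r n]
  (* unbounded search; every value before the first zero must be defined *)
  | Mu f => fun x y =>
      eval p f (cpair x y) 0%N /\
      forall k, (k < y)%N -> exists v, eval p f (cpair x k) v.+1
  end.

Definition baire_pfun : Type := baire -> option baire.

(* The machine has to produce F(p) for p in dom(F); nothing is required of it
   outside dom(F). *)
Definition computable (F : baire_pfun) : Prop :=
  exists c : code, forall p q, F p = Some q -> forall n, eval p c n (q n).

Definition bpair (p q : baire) : baire :=
  fun n => if odd n then q n./2 else p n./2.

(* A surjective partial function from Baire space onto X, given by its graph. *)
Record representation (X : Type) : Type := Representation {
  rep :> baire -> X -> Prop;
  rep_functional : forall p x y, rep p x -> rep p y -> x = y;
  rep_surjective : forall x, exists p, rep p x }.

(* A partial multi-valued map between represented spaces;
   its domain is {x | f x <> set0}. *)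
Record problem : Type := Problem {
  inputs : Type;
  outputs : Type;
  input_rep : representation inputs;
  output_rep : representation outputs;
  mvmap :> inputs -> set outputs }.

Definition realizes (F : baire_pfun) (f : problem) : Prop :=
  forall (p : baire) (x : inputs f), input_rep f p x -> f x !=set0 ->
    exists q : baire, F p = Some q /\
      exists y : outputs f, output_rep f q y /\ f x y.

Definition weihrauch_le (f g : problem) : Prop :=
  exists H K : baire_pfun, [/\ computable H, computable K &
    forall G : baire_pfun, realizes G g ->
      realizes (fun p => obind (fun q => H (bpair p q)) (obind G (K p))) f].

Definition weihrauch_lt (f g : problem) : Prop :=
  weihrauch_le f g /\ ~ weihrauch_le g f.

Notation "f <=W g" := (weihrauch_le f g) (at level 70, no associativity).
Notation "f <W g" := (weihrauch_lt f g) (at level 70, no associativity).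

Section sequences.
Variables (X : Type) (d : representation X).

Let seq_name (p : baire) (x : nat -> X) : Prop :=
  forall i, d (fun j => p (cpair i j)) (x i).

Let seq_name_functional p x y : seq_name p x -> seq_name p y -> x = y.
Proof. by move=> px py; apply/funext => i; exact: rep_functional (px i) (py i). Qed.

Let seq_name_surjective x : exists p, seq_name p x.
Proof.
have [q qx] := choice (fun i => rep_surjective d (x i)).
exists (fun n => q (unpair n).1 (unpair n).2) => i.
by have := qx i; congr (rep d _ _); apply/funext => j; rewrite cpairK.
Qed.

Definition seq_rep : representation (nat -> X) :=
  Representation seq_name_functional seq_name_surjective.

End sequences.

Definition BWT (X : topologicalType) (d : representation X) : problem :=
  @Problem (nat -> X) X (seq_rep d) d
    (fun x => [set y | compact (closure (range x)) /\ cluster (x @ \oo) y]).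

(* Hence dom(BWT_X) is the set of sequences whose range has compact closure. *)
Lemma BWT_domE (X : topologicalType) (d : representation X) (x : nat -> X) :
  BWT d x !=set0 <-> compact (closure (range x)).
Proof.
split=> [[y []]//|cx].
have [] := cx (x @ \oo); last by move=> y [_ xy]; exists y.
by exists 0%N => // n _; apply: subset_closure; exists n.
Qed.

Section first_value.

Let nat_name (p : baire) (x : nat) : Prop := p 0%N = x.

Let nat_name_functional p x y : nat_name p x -> nat_name p y -> x = y.
Proof. by move=> <-. Qed.

Let nat_name_surjective x : exists p, nat_name p x.
Proof. by exists (fun=> x). Qed.

Definition nat_rep : representation nat :=
  Representation nat_name_functional nat_name_surjective.

Variable n : nat.

Let ord_name (p : baire) (x : discrete_topology 'I_n) : Prop :=
  p 0%N = nat_of_ord x.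

Let ord_name_functional p x y : ord_name p x -> ord_name p y -> x = y.
Proof. by move=> px py; apply: val_inj; rewrite /= -px -py. Qed.

Let ord_name_surjective x : exists p, ord_name p x.
Proof. by exists (fun=> nat_of_ord x). Qed.

Definition ord_rep : representation (discrete_topology 'I_n) :=
  Representation ord_name_functional ord_name_surjective.

End first_value.

Section cauchy.
Variables (R : realType) (X : metricType R) (alpha : nat -> X).
Hypothesis alpha_dense : dense (range alpha).

Let cauchy_name (p : baire) (x : X) : Prop :=
  (forall n k, (n <= k)%N -> mdist (alpha (p n)) (alpha (p k)) < 2 ^- n) /\
  (alpha \o p) @ \oo --> x.

Let cauchy_name_functional p x y : cauchy_name p x -> cauchy_name p y -> x = y.
Proof.
by move=> [_ px] [_ py]; exact: (cvg_unique (@metric_hausdorff _ X) px py).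
Qed.

Let cauchy_name_surjective x : exists p, cauchy_name p x.
Proof.
have P (n : nat) : exists m, mdist x (alpha m) < 2 ^- n.+1.
  have e0 : 0 < 2 ^- n.+1 :> R by rewrite invr_gt0 exprn_gt0.
  have [] := @alpha_dense (interior (ball x (2 ^- n.+1))).
  - by exists x; exact: nbhsx_ballx.
  - exact: open_interior.
  move=> z [/interior_subset xz [m _ mz]]; exists m.
  by move: xz; rewrite ballEmdist mz.
have [p px] := choice P.
have le2 (n k : nat) : (n <= k)%N -> 2 ^- k <= 2 ^- n :> R.
  by move=> nk; rewrite lef_pV2 ?posrE ?exprn_gt0// ler_eXn2l// ltr1n.
exists p; split=> [n k nk|].
  apply: le_lt_trans (metric_triangle _ x _) _.
  rewrite metric_sym.
  have -> : 2 ^- n = 2 ^- n.+1 + 2 ^- n.+1 :> R.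
    by rewrite exprS invfM [RHS]addrC mulrC -splitr.
  by apply: ltrD (px n) _; apply: lt_le_trans (px k) _; exact: le2.
apply/metricType_numDomainType.cvgrPdist_lt => e e0.
have [N Ne] : exists N, 2 ^- N < e :> R.
  have /cvgrPdist_lt/(_ e e0)[N _ /(_ N (leqnn N))] :
      (fun n => (2^-1 : R) ^+ n) @ \oo --> (0 : R).
    by apply: cvg_expr; rewrite ger0_norm ?invr_ge0// invf_lt1// ltr1n.
  rewrite /= sub0r normrN exprVn ger0_norm ?invr_ge0 ?exprn_ge0// => Ne.
  by exists N.
exists N => // n /= Nn; apply: lt_trans (px n) _.
by apply: le_lt_trans Ne; apply: le2; exact: leqW.
Qed.

Definition cauchy_rep : representation X :=
  Representation cauchy_name_functional cauchy_name_surjective.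

End cauchy.

Section reals.
Variable R : realType.

(* The standard numbering of the rationals: <<i, j>, k> |-> (i - j)/(k + 1). *)
Definition rat_numbering (n : nat) : R^o :=
  let: (m, k) := unpair n in
  let: (i, j) := unpair m in
  (i%:R - j%:R) / k.+1%:R.

Lemma rat_numbering_dense : dense (range rat_numbering).
Proof.
move=> O O0 oO.
have [z [Oz [q _ qz]]] := @dense_rat R O O0 oO.
exists z; split=> //.
have [k dk] : exists k : nat, denq q = k.+1.
  by exists `|denq q|.-1%N; have := denq_gt0 q; lia.
have ratrE : ratr q = (numq q)%:~R / k.+1%:R :> R by rewrite /ratr dk.
have [i [j nij]] : exists i j : nat, numq q = i%:Z - j%:Z.
  case: (numq q) => m; first by exists m, 0%N; rewrite subr0.
  by exists 0%N, m.+1; rewrite sub0r NegzE.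
exists (cpair (cpair i j) k) => //.
by rewrite /rat_numbering !cpairK -qz ratrE nij intrB.
Qed.

Definition real_rep : representation R^o := cauchy_rep rat_numbering_dense.

End reals.

Definition BWT_ord (n : nat) : problem := BWT (ord_rep n).
Definition BWT_nat : problem := BWT nat_rep.
Definition BWT_real (R : realType) : problem := BWT (real_rep R).

(* Main.v *)
Require Import Defs.
From mathcomp Require Import all_boot all_order all_algebra.
From mathcomp Require Import all_classical all_reals all_analysis.
From mathcomp Require Import zify lra.
(* MathComp-Analysis has an [eval] of its own; this makes [eval] mean [Defs.eval]. *)
Import Defs.

(* The reductions embed a discrete space into the next space by a map that is
   computable on names; from BWT_R one recovers the integer answer by rounding.

   The separations are forcing arguments that use of the reduction only that the
   outer machine reads finitely much of its oracle. If BWT_n (or BWT_N) is given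
   by names depending only on the answer j, the solution of the instance p is a
   computation from p and some j. One builds p deciding one j at a time: either no
   admissible extension makes the machine output anything for j, or a finite part
   of p fixes the output and all later terms of p are kept away from it. Over n
   answers, n deletions leave one of the values 0, ..., n; over all natural
   numbers j, a nested sequence of intervals keeps the cluster points of p away
   from every output. *)

Set Implicit Arguments.
Unset Strict Implicit.
Unset Printing Implicit Defensive.

Import Order.TTheory GRing.Theory Num.Theory.
Import numFieldNormedType.Exports.

Local Open Scope classical_set_scope.
Local Open Scope ring_scope.

(** * Oracle machines *)

Lemma eval_functional p c x y z : eval p c x y -> eval p c x z -> y = z.
Proof.
elim: c x y z => [||||| f IHf g IHg | f IHf g IHg | f IHf g IHg | f IHf] x y z /=;
  try by move=> -> ->.
- move=> [a [b [fa gb ->]]] [a' [b' [fa' gb' ->]]].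
  by rewrite (IHf _ _ _ fa fa') (IHg _ _ _ gb gb').
- move=> [a ga fa] [b gb fb]; move: fb; rewrite -(IHg _ _ _ ga gb).
  exact: IHf fa.
- case: (unpair x) => a n [r [r0 rS ->]] [s [s0 sS ->]].
  suff rs k : (k <= n)%N -> r k = s k by exact: rs.
  elim: k => [_|k IHk kn]; first exact: IHf r0 s0.
  by apply: IHg (rS _ kn) _; rewrite IHk; [exact: sS|exact: ltnW].
(* If two searches stopped at different places, the value at the smaller one would be both zero and
   a successor. *)
- move=> [fy yz] [fz zy]; case: (ltngtP y z) => // [/zy|/yz] [v fv].
    by have := IHf _ _ _ fy fv.
  by have := IHf _ _ _ fz fv.
Qed.

Lemma bounded_use (n : nat) (P : nat -> nat -> Prop) :
  (forall k, (k < n)%N -> exists N, P k N) ->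
  (forall k N M, (N <= M)%N -> P k N -> P k M) ->
  exists N, forall k, (k < n)%N -> P k N.
Proof.
move=> PN Pmono; elim: n PN => [|n IHn] PN; first by exists 0%N.
have [N NP] : exists N, forall k, (k < n)%N -> P k N.
  by apply: IHn => k kn; apply: PN; exact: ltnW.
have [M MP] := PN n (ltnSn n).
exists (maxn N M) => k; rewrite ltnS leq_eqVlt => /predU1P[->|/NP].
  by apply: Pmono MP; exact: leq_maxr.
by apply: Pmono; exact: leq_maxl.
Qed.

Definition agree_below (N : nat) (p q : baire) : Prop :=
  forall k, (k < N)%N -> p k = q k.

Lemma agree_belowW N M p q : (N <= M)%N -> agree_below M p q -> agree_below N p q.
Proof. by move=> NM pq k kN; apply: pq; exact: leq_trans NM. Qed.

(** A halting computation is a finite tree of sub-evaluations, so it makes only finitely many oracle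
    queries. In [Prec] and [Mu] the number of branches depends on the input or output, and
    [bounded_use] supplies the common bound. *)
Lemma eval_finite_use p c x y : eval p c x y ->
  exists N, forall q, agree_below N p q -> eval q c x y.
Proof.
elim: c x y => [||||| f IHf g IHg | f IHf g IHg | f IHf g IHg | f IHf] x y /=;
  try by move=> ->; exists 0%N.
- by move=> ->; exists x.+1 => q ->.
- move=> [a [b [/IHf[N fN] /IHg[M gM] ->]]]; exists (maxn N M) => q pq.
  exists a, b; split=> //; first by apply/fN/(agree_belowW _ pq)/leq_maxl.
  by apply/gM/(agree_belowW _ pq)/leq_maxr.
- move=> [a /IHg[M gM] /IHf[N fN]]; exists (maxn N M) => q pq.
  exists a; first by apply/gM/(agree_belowW _ pq)/leq_maxr.
  by apply/fN/(agree_belowW _ pq)/leq_maxl.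
- case: (unpair x) => a n [r [/IHf[N fN] rS ->]].
  have [||M gM] := @bounded_use n (fun k M => forall q, agree_below M p q ->
    eval q g (cpair a (cpair k (r k))) (r k.+1)).
  + by move=> k /rS/IHg.
  + by move=> k A B AB HA q pq; apply: HA; exact: agree_belowW pq.
  exists (maxn N M) => q pq; exists r; split=> //.
    by apply/fN/(agree_belowW _ pq)/leq_maxl.
  by move=> k kn; apply: gM => //; apply/(agree_belowW _ pq)/leq_maxr.
- move=> [/IHf[N fN] fS].
  have [||M gM] := @bounded_use y (fun k M => forall q, agree_below M p q ->
    exists v, eval q f (cpair x k) v.+1).
  + by move=> k /fS[v /IHf[M fM]]; exists M => q pq; exists v; exact: fM.
  + by move=> k A B AB HA q pq; apply: HA; exact: agree_belowW pq.
  exists (maxn N M) => q pq; split; first by apply/fN/(agree_belowW _ pq)/leq_maxl.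
  by move=> k ky; apply: gM => //; apply/(agree_belowW _ pq)/leq_maxr.
Qed.

(** * Closure properties of total computable operations *)

Definition computable_op (F : baire -> baire) : Prop :=
  exists c, forall p n, eval p c n (F p n).

Lemma computable_op_total F : computable_op F -> computable (Some \o F).
Proof. by move=> [c cF]; exists c => p _ [<-]. Qed.

Lemma computable_op_zero : computable_op (fun _ _ => 0%N).
Proof. by exists Zero. Qed.

Lemma computable_op_succ F : computable_op F -> computable_op (fun p n => (F p n).+1).
Proof. by move=> [c cF]; exists (Comp Succ c) => p n; exists (F p n). Qed.

Lemma computable_op_fst F : computable_op F ->
  computable_op (fun p n => (unpair (F p n)).1).
Proof. by move=> [c cF]; exists (Comp Fst c) => p n; exists (F p n). Qed.

Lemma computable_op_snd F : computable_op F ->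
  computable_op (fun p n => (unpair (F p n)).2).
Proof. by move=> [c cF]; exists (Comp Snd c) => p n; exists (F p n). Qed.

Lemma computable_op_oracle F : computable_op F -> computable_op (fun p n => p (F p n)).
Proof. by move=> [c cF]; exists (Comp Oracle c) => p n; exists (F p n). Qed.

Lemma computable_op_pair F G : computable_op F -> computable_op G ->
  computable_op (fun p n => cpair (F p n) (G p n)).
Proof.
by move=> [c cF] [d dG]; exists (Pair c d) => p n; exists (F p n), (G p n).
Qed.

Lemma computable_op_id : computable_op (fun _ n => n).
Proof.
exists (Pair Fst Snd) => p n /=; exists (unpair n).1, (unpair n).2; split=> //.
by rewrite unpairK.
Qed.

Lemma computable_op_const m : computable_op (fun _ _ => m).
Proof.
by elim: m => [|m IHm]; [exact: computable_op_zero|exact: computable_op_succ].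
Qed.

Lemma computable_op_comp F G : computable_op F -> computable_op G ->
  computable_op (fun p n => F p (G p n)).
Proof. by move=> [c cF] [d dG]; exists (Comp c d) => p n; exists (G p n). Qed.

Lemma computable_op_rec F G : computable_op F -> computable_op G ->
  computable_op (fun p n => nat_rect (fun=> nat) (F p (unpair n).1)
    (fun k r => G p (cpair (unpair n).1 (cpair k r))) (unpair n).2).
Proof.
move=> [c cF] [d dG]; exists (Prec c d) => p n /=; case: (unpair n) => a m /=.
by exists (nat_rect (fun=> nat) (F p a) (fun k r => G p (cpair a (cpair k r)))).
Qed.

(** [Mu] returns the first zero of [F]; positivity before [m] gives the successor values that its
    semantics demands there. *)
Lemma computable_op_search F (m : baire -> baire) : computable_op F ->
  (forall p n, F p (cpair n (m p n)) = 0%N) ->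
  (forall p n k, (k < m p n)%N -> (0 < F p (cpair n k))%N) ->
  computable_op m.
Proof.
move=> [c cF] Fm0 Fm; exists (Mu c) => p n; split; first by rewrite -(Fm0 p n).
by move=> k /Fm F0; exists (F p (cpair n k)).-1; rewrite prednK.
Qed.

Lemma computable_op_rec2 F G A B : computable_op F -> computable_op G ->
  computable_op A -> computable_op B ->
  computable_op (fun p n => nat_rect (fun=> nat) (F p (A p n))
    (fun k r => G p (cpair (A p n) (cpair k r))) (B p n)).
Proof.
move=> cF cG cA cB.
have := computable_op_comp (computable_op_rec cF cG) (computable_op_pair cA cB).
by congr computable_op; apply/funext => p; apply/funext => n; rewrite cpairK.
Qed.

Lemma computable_op_add F G : computable_op F -> computable_op G ->
  computable_op (fun p n => F p n + G p n)%N.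
Proof.
move=> cF cG.
have := computable_op_rec2 computable_op_id
  (computable_op_succ (computable_op_snd (computable_op_snd computable_op_id))) cF cG.
congr computable_op; apply/funext => p; apply/funext => n.
by elim: (G p n) => [|m IHm] /=; rewrite ?addn0// !cpairK /= IHm addnS.
Qed.

Lemma computable_op_mul F G : computable_op F -> computable_op G ->
  computable_op (fun p n => F p n * G p n)%N.
Proof.
move=> cF cG; have cid := computable_op_id.
have := computable_op_rec2 computable_op_zero (computable_op_add
  (computable_op_fst cid) (computable_op_snd (computable_op_snd cid))) cF cG.
congr computable_op; apply/funext => p; apply/funext => n.
by elim: (G p n) => [|m IHm] /=; rewrite ?muln0// !cpairK /= IHm mulnS.
Qed.

Lemma computable_op_pred F : computable_op F -> computable_op (fun p n => (F p n).-1).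
Proof.
move=> cF.
(* The recursion step returns the counter [k] itself, so [m.+1] rounds end in [m]. *)
have := computable_op_rec2 computable_op_zero
  (computable_op_fst (computable_op_snd computable_op_id)) computable_op_zero cF.
congr computable_op; apply/funext => p; apply/funext => n.
by case: (F p n) => [|m] //=; rewrite !cpairK.
Qed.

Lemma computable_op_sub F G : computable_op F -> computable_op G ->
  computable_op (fun p n => F p n - G p n)%N.
Proof.
move=> cF cG.
have := computable_op_rec2 computable_op_id (computable_op_pred
  (computable_op_snd (computable_op_snd computable_op_id))) cF cG.
congr computable_op; apply/funext => p; apply/funext => n.
by elim: (G p n) => [|m IHm] /=; rewrite ?subn0// !cpairK /= IHm subnS.
Qed.

(** * Reductions *)

(** The image of the compact closure is compact, hence closed in a Hausdorff space, and it contains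
    the range of [f \o x]. *)
Lemma compact_closure_range_comp (X Y : topologicalType) (f : X -> Y) (x : nat -> X) :
  hausdorff_space Y -> continuous f -> compact (closure (range x)) ->
  compact (closure (range (f \o x))) /\
  closure (range (f \o x)) `<=` f @` closure (range x).
Proof.
move=> hY cf cx.
have cfx : compact (f @` closure (range x)).
  by apply: continuous_compact => //; exact: continuous_subspaceT.
have sub : closure (range (f \o x)) `<=` f @` closure (range x).
  rewrite closureE; apply: smallest_sub; first exact: compact_closed.
  by move=> _ [n _ <-]; exists (x n) => //; apply: subset_closure; exists n.
by split=> //; apply: subclosed_compact sub => //; exact: closed_closure.
Qed.

Lemma cluster_seqP (X : topologicalType) (x : nat -> X) (y : X) :
  cluster (x @ \oo) y <->
  (forall U N, nbhs y U -> exists2 k, (N <= k)%N & U (x k)).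
Proof.
split=> [xy U N yU|xy A B [N _ NA] yB].
  have [|_ [[k Nk <-] Uk]] := xy (x @` [set k | (N <= k)%N]) U _ yU.
    by exists N => // k Nk; exists k.
  by exists k.
by have [k Nk Bk] := xy B N yB; exists (x k); split=> //; exact: NA.
Qed.

Lemma seq_repE (X : Type) (d : representation X) p x :
  seq_rep d p x = forall i, d (fun j => p (cpair i j)) (x i).
Proof. by []. Qed.

Lemma bpair_oddE p q n : bpair p q n.*2.+1 = q n.
Proof. by rewrite /bpair /= odd_double /= uphalf_double. Qed.

(** For a topological embedding [f], a cluster point of [f \o x] lies in the image of the closure of
    the range of [x], so it is some [f z], and [z] clusters [x] because neighborhoods pull back. [k]
    translates names of instances and [h] turns a name of [f z] into one of [z]. *)
Lemma BWT_embedding_le (X Y : topologicalType) (dX : representation X)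
    (dY : representation Y) (f : X -> Y) (h k : baire -> baire) :
  hausdorff_space Y -> continuous f ->
  (forall z U, nbhs z U -> exists2 V, nbhs (f z) V & f @^-1` V `<=` U) ->
  computable_op h -> computable_op k ->
  (forall p x, seq_rep dX p x -> seq_rep dY (k p) (f \o x)) ->
  (forall p q z, dY q (f z) -> dX (h (bpair p q)) z) ->
  BWT dX <=W BWT dY.
Proof.
move=> hY cf embf ch ck kP hP; exists (Some \o h), (Some \o k).
split; [exact: computable_op_total|exact: computable_op_total|].
move=> G rG p x px /BWT_domE cx.
have [cfx sub] := compact_closure_range_comp hY cf cx.
have [|q [/= -> [y [qy [_ xy]]]] /=] := rG (k p) (f \o x) (kP _ _ px).
  exact/BWT_domE.
exists (h (bpair p q)); split=> //.
have [z _ zy] : (f @` closure (range x)) y.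
  apply: sub; move: xy; rewrite clusterE; apply.
  by exists 0%N => // n _; exists n.
exists z; split; first by apply: hP; rewrite zy.
split=> //; apply/cluster_seqP => U N /embf[V fzV VU].
move/cluster_seqP : xy => /(_ V N); rewrite -zy => /(_ fzV)[n Nn Vn].
by exists n => //; exact: VU.
Qed.

Lemma computable_op_bpair_snd : computable_op (fun p n => p n.*2.+1).
Proof.
apply: computable_op_oracle; apply: computable_op_succ.
rewrite (_ : (fun _ : baire => double) = fun _ n => (n + n)%N).
  by apply: computable_op_add; exact: computable_op_id.
by apply/funext => p; apply/funext => n; rewrite addnn.
Qed.

Lemma BWT_discrete_le (X Y : discreteTopologicalType) (dX : representation X)
    (dY : representation Y) (f : X -> Y) :
  injective f -> (forall p z, dX p z <-> dY p (f z)) -> BWT dX <=W BWT dY.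
Proof.
move=> injf df; apply: (@BWT_embedding_le _ _ dX dY f (fun p n => p n.*2.+1) id).
- exact: discrete_hausdorff.
- by move=> z U /=; rewrite !nbhs_principalE => /principal_filterP Uz;
    apply/principal_filterP.
- move=> z U /nbhs_singleton Uz; exists [set f z]; first exact: discrete_set1.
  by move=> z' /injf ->.
- exact: computable_op_bpair_snd.
- by apply: computable_op_oracle; exact: computable_op_id.
- by move=> p x; rewrite !seq_repE => px i; apply/df; exact: px.
- move=> p q z /df; congr (rep dX _ _).
  by apply/funext => n; rewrite bpair_oddE.
Qed.

Lemma BWT_ord_le_ordS n : BWT_ord n <=W BWT_ord n.+1.
Proof.
apply: (@BWT_discrete_le (discrete_topology 'I_n) (discrete_topology 'I_n.+1)
  _ _ (widen_ord (leqnSn n))) => // i j ij.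
by apply: val_inj; have := congr1 val ij.
Qed.

Lemma BWT_ord_le_nat n : BWT_ord n <=W BWT_nat.
Proof.
apply: (@BWT_discrete_le (discrete_topology 'I_n) nat _ _ (@nat_of_ord n)) => //.
exact: ord_inj.
Qed.

(* [rat_numbering] with values in [R] rather than in its alias [R^o], whose
   separate ring structure the arithmetic tactics do not identify with that of [R]. *)
Definition rat_val (R : realType) (e : nat) : R := rat_numbering R e.

Lemma rat_valE (R : realType) (e : nat) : rat_val R e =
  ((unpair (unpair e).1).1%:R - (unpair (unpair e).1).2%:R) / (unpair e).2.+1%:R.
Proof.
by rewrite /rat_val /rat_numbering; case: (unpair e) => a c; case: (unpair a).
Qed.

(* The least [m] with [rat_val e < m + 1/2], found by unbounded search. *)
Lemma computable_op_round (R : realType) : exists2 r : nat -> nat,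
  (forall F, computable_op F -> computable_op (fun p n => r (F p n))) &
  forall e m, `|m%:R - rat_val R e| <= 2^-1 ^+ 2 -> r e = m.
Proof.
(* For [e] coding [(i - j)/(c + 1)], the truncated difference vanishes iff
   [2i + 1 <= (2m + 1)(c + 1) + 2j], that is, iff [(i - j)/(c + 1) < m + 1/2]. *)
pose s e m := (((unpair (unpair e).1).1 + (unpair (unpair e).1).1).+1 -
  ((m + m).+1 * (unpair e).2.+1 +
   ((unpair (unpair e).1).2 + (unpair (unpair e).1).2)))%N.
have s0 e : exists m, s e m == 0%N.
  by exists (unpair (unpair e).1).1; apply/eqP; rewrite /s; nia.
exists (fun e => ex_minn (s0 e)).
  move=> F cF; apply: (@computable_op_comp (fun _ e => ex_minn (s0 e)) F) => //.
  apply: (@computable_op_search (fun _ x => s (unpair x).1 (unpair x).2)).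
  - have c1 := computable_op_fst computable_op_id.
    have c2 := computable_op_snd computable_op_id.
    have c11 := computable_op_fst (computable_op_fst c1).
    have c12 := computable_op_snd (computable_op_fst c1).
    apply: computable_op_sub.
      by apply: computable_op_succ; exact: computable_op_add.
    apply: computable_op_add; last exact: computable_op_add.
    apply: computable_op_mul; apply: computable_op_succ.
      exact: computable_op_add.
    exact: computable_op_snd.
  - by move=> p e; rewrite cpairK; case: ex_minnP => m /eqP.
  - move=> p e k; rewrite cpairK /=; case: ex_minnP => m _ min km.
    rewrite lt0n; apply/negP => /min; by rewrite leqNgt km.
move=> e m; rewrite rat_valE.
have : forall k, (s e k == 0%N) = ((unpair (unpair e).1).1%:R -
    (unpair (unpair e).1).2%:R < (k%:R + 2^-1) * (unpair e).2.+1%:R :> R).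
  move=> k; rewrite /s; case: (unpair e) => a c; case: (unpair a) => i j /=.
  rewrite subn_eq0.
  rewrite -(ltr_nat R) !natrD natrM -[(k + k).+1%:R]natr1 natrD.
  by move: c.+1%:R => C; apply/idP/idP => H; lra.
case: (unpair e) => a c; case: (unpair a) => i j /= sE.
have c0 : 0 < c.+1%:R :> R by rewrite ltr0n.
have {}sE k : (s e k == 0%N) = ((i%:R - j%:R) / c.+1%:R < k%:R + 2^-1 :> R).
  by rewrite sE ltr_pdivrMr.
(* An error of at most 1/4 puts [x] below [m + 1/2] and above [(m - 1) + 1/2], so the search stops
   exactly at [m]. *)
move: (_ / _) sE => x sE; rewrite ler_norml expr2 => /andP[le1 le2].
case: ex_minnP => k; rewrite sE => ltk mink.
apply/eqP; rewrite eqn_leq mink ?sE; last by lra.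
by rewrite -ltnS -(ltr_nat R) -natr1; lra.
Qed.

Lemma nat_real_continuous (R : realType) : continuous (fun m : nat => m%:R : R^o).
Proof.
move=> m U /nbhs_singleton Um /=; rewrite nbhs_simpl /= nbhs_principalE.
exact/principal_filterP.
Qed.

(** The Cauchy estimates between terms of the name pass to the limit, where the strict inequality
    becomes weak. *)
Lemma real_repP (R : realType) q (y : R) : real_rep R q y ->
  forall n, `|y - rat_val R (q n)| <= 2^-1 ^+ n.
Proof.
move=> [qC qy] n; rewrite exprVn; apply/ler_addgt0Pr => e e0.
have {}qy : (rat_val R \o q) @ \oo --> y by exact: qy.
have /cvgrPdist_lt/(_ e e0)[N _ qN] := qy.
have /= yN := qN _ (leq_maxl N n).
have : `|rat_val R (q (maxn N n)) - rat_val R (q n)| < 2 ^- n := qC _ _ (leq_maxr N n).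
move=> qn; apply: le_trans (ler_distD (rat_val R (q (maxn N n))) _ _) _.
by rewrite addrC; apply: ltW; exact: ltrD.
Qed.

Lemma real_rep_const (R : realType) e : real_rep R (fun=> e) (rat_numbering R e).
Proof.
split; last exact: cvg_cst.
by move=> n k _; rewrite /mdist /= subrr normr0 invr_gt0 exprn_gt0.
Qed.

Lemma BWT_nat_le_real (R : realType) : BWT_nat <=W BWT_real R.
Proof.
have [r cr rP] := computable_op_round R.
(* The natural number [m] is sent to the constant Cauchy name of [(m - 0)/1]. Position 5 of the
   paired oracle is entry 2 of the real answer, which has error at most 1/4 and can be rounded. *)
apply: (@BWT_embedding_le nat R^o _ _ (fun m => m%:R)
  (fun p _ => r (p 5)) (fun p n => cpair (cpair (p (cpair (unpair n).1 0)) 0) 0)).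
- exact: metric_hausdorff.
- exact: nat_real_continuous.
- move=> m U /nbhs_singleton Um; exists (ball (m%:R : R^o) 1).
    exact: nbhsx_ballx.
  move=> k mk; suff -> : k = m by [].
  have : `|m%:R - k%:R| < 1 :> R := mk.
  rewrite ltr_norml => /andP[{}mk km].
  have le_km (a b : nat) : a%:R - b%:R < 1 :> R -> (a <= b)%N.
    by move=> ab; rewrite -ltnS -(ltr_nat R) -natr1; lra.
  by apply/eqP; rewrite eqn_leq !le_km//; lra.
- apply: cr; apply: computable_op_oracle; exact: computable_op_const.
- apply: computable_op_pair; last exact: computable_op_zero.
  apply: computable_op_pair; last exact: computable_op_zero.
  apply: computable_op_oracle; apply: computable_op_pair; last exact: computable_op_zero.
  apply: computable_op_fst; exact: computable_op_id.
- move=> p x; rewrite !seq_repE => px i; rewrite /= -(px i).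
  set e := cpair (cpair (p (cpair i 0)) 0) 0.
  have := real_rep_const R e; congr (rep _ _ _).
    by apply/funext => j; rewrite cpairK.
  by rewrite /rat_numbering /e !cpairK /= subr0 divr1.
- move=> p q m /real_repP/(_ 2%N) /rP <-.
  by rewrite /= -(bpair_oddE p q 2).
Qed.

(** * Separations *)

(** A reduction has to work with every realizer, so it may be tested on one built by choice that
    always returns the fixed name of the answer it picks. *)
Lemma realizer_with_names (g : problem) (name : outputs g -> baire) :
  (forall y, output_rep g (name y) y) ->
  exists2 G, realizes G g & forall p q, G p = Some q -> exists y, q = name y.
Proof.
move=> nameP.
pose good p y := exists2 x, input_rep g p x & g x y.
have [G GP] : {G : baire_pfun & forall p, match G p with
    | Some q => exists2 y, good p y & q = name y
    | None => forall y, ~ good p y end}.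
  apply: (@choice _ _ (fun p o => match o with
    | Some q => exists2 y, good p y & q = name y
    | None => forall y, ~ good p y end)) => p.
  have [[y py]|npy] := pselect (exists y, good p y).
    by exists (Some (name y)); exists y.
  by exists None => y py; apply: npy; exists y.
exists G => [p x px [y xy]|p q Gpq]; last first.
  by have := GP p; rewrite Gpq => -[y _ ->]; exists y.
have := GP p; case: (G p) => [q [z [x' px' x'z] ->]|/(_ y)[]]; last by exists x.
exists (name z); split=> //; exists z; split=> //.
by rewrite (rep_functional px px').
Qed.

(** Feeding the reduction a realizer with fixed names leaves one machine that solves each instance
    from [p] and a single [name y]; [K] only influences which [y] occurs. *)
Lemma weihrauch_le_code (f g : problem) (name : outputs g -> baire) :
  (forall y, output_rep g (name y) y) -> f <=W g ->
  exists c, forall p x, input_rep f p x -> f x !=set0 ->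
    exists y r z, [/\ forall m, eval (bpair p (name y)) c m (r m),
      output_rep f r z & f x z].
Proof.
move=> /realizer_with_names[G rG Gname] [H [K [[c cH] _ /(_ G rG) rf]]].
exists c => p x px fx; have [r [+ [z [rz xz]]]] := rf p x px fx.
case: (K p) => //= k; case Gk: (G k) => [q|]//= Hr.
have [y qy] := Gname _ _ Gk; exists y, r, z; split=> // m.
by apply: cH; rewrite -qy.
Qed.

(** * Forcing conditions on names of sequences *)

Lemma unpair1_le n : ((unpair n).1 <= n)%N.
Proof.
suff : ((unpair n).1 + (unpair n).2 <= n)%N by apply: leq_trans; exact: leq_addr.
by elim: n => //= n; case: (unpair n) => -[|i] j /=; lia.
Qed.

(** The [i]-th component is the constant stream [e i], which names [e i] in a discrete space and the
    rational with code [e i] in the reals. *)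
Definition const_names (e : nat -> nat) : baire := fun n => e (unpair n).1.

Lemma agree_below_const_names N e e' q : agree_below N e e' ->
  agree_below N (bpair (const_names e) q) (bpair (const_names e') q).
Proof.
move=> ee' k kN; rewrite /bpair /const_names; case: odd => //; apply: ee'.
by apply: leq_ltn_trans kN; apply: leq_trans (unpair1_le _) _; lia.
Qed.

(* [(e0, N, A)] is a forcing condition: it fixes the first [N] terms of the
   sequence under construction and confines all later terms to [A]. *)
Definition follows (e0 : nat -> nat) (N : nat) (A : set nat) (e : nat -> nat) : Prop :=
  agree_below N e0 e /\ forall k, (N <= k)%N -> A (e k).

Lemma follows_trans e0 N A e1 M B e : (N <= M)%N -> B `<=` A ->
  follows e0 N A e1 -> follows e1 M B e -> follows e0 N A e.
Proof.
move=> NM BA [e01 Ae1] [e1e Be]; split=> k kN.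
  by rewrite e01// e1e//; exact: leq_trans NM.
by case: (ltnP k M) => [kM|/Be/BA//]; rewrite -e1e//; exact: Ae1.
Qed.

Lemma follows_tail e0 N A e1 M w : (N <= M)%N -> A w -> follows e0 N A e1 ->
  follows e0 N A (fun k => if (k < M)%N then e1 k else w).
Proof.
move=> NM Aw [e01 Ae1]; split=> k kN; last by case: ifP => // _; exact: Ae1.
by rewrite (leq_trans kN NM) e01.
Qed.

(** The dichotomy behind both separations: if some admissible sequence yields an output, finite use
    lets an initial segment of it guarantee that output. *)
Lemma force_output c q m e0 N A :
  (forall e v, follows e0 N A e -> ~ eval (bpair (const_names e) q) c m v) \/
  exists e1 M v, follows e0 N A e1 /\
    forall e, agree_below M e1 e -> eval (bpair (const_names e) q) c m v.
Proof.
have [[e1 [v [e1P /eval_finite_use[M MP]]]]|no] := pselect (exists e v,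
    follows e0 N A e /\ eval (bpair (const_names e) q) c m v).
  right; exists e1, M, v; split=> // e e1e; apply: MP.
  exact: agree_below_const_names.
by left=> e v eP ev; apply: no; exists e, v.
Qed.

(* For each answer [q i] in turn, the value that some admissible sequence forces
   the machine to output is deleted from the list of values still allowed. *)
Lemma avoid_finitely_many c n (q : nat -> baire) : exists e N w,
  [/\ forall k, (e k <= n)%N, (w <= n)%N, forall k, (N <= k)%N -> e k = w &
      forall i, (i < n)%N -> ~ eval (bpair (const_names e) (q i)) c 0%N w].
Proof.
suff [e [N [s [en [sn ss uniqs] eP avoid]]]] : exists e N (s : seq nat),
    [/\ forall k, (e k <= n)%N,
        [/\ all (fun w => w <= n)%N s, (n.+1 - n <= size s)%N & uniq s],
        follows e N [set` s] e &
        forall i e' v, (i < n)%N -> follows e N [set` s] e' ->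
          eval (bpair (const_names e') (q i)) c 0%N v -> v \notin s].
  case: s sn ss uniqs eP avoid => [|w s sn _ _ eP avoid]; first by rewrite subSnn.
  have ws : w \in w :: s by rewrite mem_head.
  have wn : (w <= n)%N by case/andP: sn.
  (* Continuing by a surviving value [w] is admissible, so an output [w] would contradict that
     outputs have been removed from [s]. *)
  exists (fun k => if (k < N)%N then e k else w), N, w; split=> //.
  - by move=> k; case: ifP.
  - by move=> k; rewrite leqNgt => /negbTE ->.
  - move=> i iN ev; have := avoid _ _ _ iN (follows_tail (leqnn N) _ eP) ev.
    by rewrite ws => /(_ ws).
(* Invariant after the first [j] answers: at least [n.+1 - j] values are left, and none of them is
   an output for a treated answer along any sequence following the condition. *)
suff : forall j, (j <= n)%N -> exists e N (s : seq nat),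
    [/\ forall k, (e k <= n)%N,
        [/\ all (fun w => w <= n)%N s, (n.+1 - j <= size s)%N & uniq s],
        follows e N [set` s] e &
        forall i e' v, (i < j)%N -> follows e N [set` s] e' ->
          eval (bpair (const_names e') (q i)) c 0%N v -> v \notin s].
  by move=> /(_ n (leqnn n)).
elim=> [_|j IHj jn].
  exists (fun=> 0%N), 0%N, (iota 0 n.+1); split=> //.
  split; [|by rewrite size_iota|exact: iota_uniq].
  by apply/allP => w; rewrite mem_iota.
have [e [N [s [en [sn ss us] eP avoid]]]] := IHj (ltnW jn).
have [no|[e1 [M [v [e1P ev]]]]] := force_output c (q j) 0%N e N [set` s].
  exists e, N, s; split=> //; first by split=> //; lia.
  move=> i e' v; rewrite ltnS leq_eqVlt => /predU1P[->|ij]; last exact: avoid.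
  by move=> e'P /(no _ _ e'P).
have s's : [set` rem v s] `<=` [set` s] by move=> w /mem_rem.
have ss' : (n.+1 - j.+1 <= size (rem v s))%N.
  have [vs|vs] := boolP (v \in s); first by rewrite size_rem// subnS -!subn1 leq_sub2r.
  by rewrite rem_id// subnS (leq_trans (leq_pred _)).
have [w ws'] : exists w, w \in rem v s.
  by case: (rem v s) ss' => [|w t]; [rewrite /=; lia|exists w; exact: mem_head].
(* Keeping [e1] up to [M] preserves the forced output [v]; the tail then uses a value that survives
   the deletion of [v]. *)
pose e2 k := if (k < maxn N M)%N then e1 k else w.
have NM := leq_maxl N M; have MM := leq_maxr N M.
have e2P : follows e N [set` s] e2 by apply: follows_tail => //; exact: s's.
exists e2, (maxn N M), (rem v s); split.
- move=> k; case: (ltnP k N) => kN; first by rewrite -e2P.1.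
  by have := e2P.2 k kN; move/allP : sn; exact.
- split=> //; last exact: rem_uniq.
  by apply/allP => u /mem_rem; move/allP : sn; exact.
- by split=> // k; rewrite /e2 leqNgt => /negbTE ->.
- move=> i e' u; rewrite ltnS leq_eqVlt => /predU1P[->|ij] e'P; last first.
    move=> /(avoid _ _ _ ij (follows_trans NM s's e2P e'P)).
    by apply: contra => /mem_rem.
  have : eval (bpair (const_names e') (q j)) c 0%N v.
    apply: ev => k kM; have kNM := leq_trans kM MM.
    by rewrite -e'P.1 /e2 kNM.
  by move=> /eval_functional/[apply] <-; rewrite mem_rem_uniqF.
Qed.

Lemma cluster_eventually_const (X : discreteTopologicalType) (x : nat -> X) N w y :
  (forall k, (N <= k)%N -> x k = w) -> cluster (x @ \oo) y -> y = w.
Proof.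
move=> xw /cluster_seqP/(_ [set y] N (discrete_set1 y))[k Nk /= <-].
exact: xw.
Qed.

Lemma finite_range_compact (X : discreteTopologicalType) (x : nat -> X) :
  finite_set (range x) -> compact (closure (range x)).
Proof.
move=> fx; have /closure_id <- : closed (range x) := discrete_closed _.
exact: finite_compact.
Qed.

(** A sequence that ends in the value [w] has no other cluster point, so the machine must output [w]
    for one of the [n] answers, and [w] was chosen to be avoided for all of them. *)
Lemma BWT_nle_ord (X : discreteTopologicalType) (d : representation X) n
    (v : X -> nat) :
  (forall p x, d p x <-> p 0%N = v x) -> (forall w, (w <= n)%N -> exists x, v x = w) ->
  ~ BWT d <=W BWT_ord n.
Proof.
move=> dP vsurj.
move=> /(@weihrauch_le_code _ (BWT_ord n) (fun (y : 'I_n) _ => nat_of_ord y)).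
move=> /(_ (fun=> erefl))[c cP].
have [e [N [w [en wn eN avoid]]]] := avoid_finitely_many c n (fun j _ => j).
(* [g] picks a point for each value up to [n]; above [n] a point over 0 serves as default. *)
have [g gP] : {g : nat -> X & forall u, (u <= n)%N -> v (g u) = u}.
  apply: (@choice _ _ (fun u x => (u <= n)%N -> v x = u)) => u.
  have [/vsurj[x <-]|un] := leqP u n; first by exists x.
  by have [x _] := vsurj 0%N (leq0n n); exists x.
have px : seq_rep d (const_names e) (g \o e).
  by rewrite seq_repE => i; apply/dP; rewrite /const_names cpairK /= gP.
have [|y [r [z [ev rz [_ xz]]]]] := cP _ _ px.
  apply/BWT_domE/finite_range_compact.
  apply: (@sub_finite_set _ _ (g @` `I_n.+1)); last exact/finite_image/finite_II.
  by move=> _ [k _ <-] /=; exists (e k) => //=; rewrite ltnS.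
apply: (avoid y (ltn_ord y)); have := ev 0%N.
have -> : r 0%N = w; last by [].
have /dP -> := rz; rewrite (@cluster_eventually_const _ (g \o e) N (g w) z) ?gP//.
by move=> k /eN /= ->.
Qed.

(** * Nested intervals against countably many answers *)

Lemma fusion (E : nat -> nat -> nat) (N : nat -> nat) (A : nat -> set nat) :
  (forall j, (N j < N j.+1)%N) -> (forall j, A j.+1 `<=` A j) ->
  (forall j, follows (E j) (N j) (A j) (E j)) ->
  (forall j, follows (E j) (N j) (A j) (E j.+1)) ->
  exists e, forall j, follows (E j) (N j) (A j) e.
Proof.
move=> NS AS EE ES.
have N_ge j : (j <= N j)%N by elim: j => // j IHj; exact: leq_ltn_trans (NS j).
have Nmono i k : (N i <= N (i + k))%N.
  by elim: k => [|k IHk]; rewrite ?addn0// addnS (leq_trans IHk)// ltnW.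
have Amono i k : A (i + k)%N `<=` A i.
  by elim: k => [|k IHk]; rewrite ?addn0// addnS => x /AS /IHk.
have Emono i k : follows (E i) (N i) (A i) (E (i + k)%N).
  elim: k => [|k IHk]; rewrite ?addn0// addnS.
  exact: follows_trans (Nmono i k) (Amono i k) IHk (ES _).
(* The diagonal works because [k < N k.+1]: term [k] is settled from stage [k.+1] on. *)
exists (fun k => E k.+1 k) => j; split=> k kN.
  case: (leqP j k.+1) => [/subnKC <-|/ltnW/subnKC <-].
    by have [-> //] := Emono j (k.+1 - j)%N.
  by have [<-//] := Emono k.+1 (j - k.+1)%N; exact: N_ge.
have jk : (j <= k.+1)%N by rewrite (leq_trans (N_ge j))// ltnW.
by have [_ /(_ k kN)] := Emono j (k.+1 - j)%N; rewrite subnKC.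
Qed.

(** The intervals are closed, so that confining the terms of a sequence also confines its cluster
    points. *)
Definition in_itv_codes (R : realType) (a b : R) : set nat :=
  [set k | a <= rat_val R k <= b].

Lemma rat_val_dense (R : realType) (a b : R) : a < b -> exists k, a <= rat_val R k <= b.
Proof.
move=> ab; have [|z [abz [k _ kz]]] :=
  @rat_numbering_dense R [set` `]a, b[] _ (itv_open a b).
  by exists ((a + b) / 2); rewrite /= in_itv /=; lra.
move: abz; rewrite /= in_itv /= => /andP[az zb].
by exists k; rewrite /rat_val kz !ltW.
Qed.

(** The center [x] lies on one side of the midpoint; a ball of radius less than a quarter of the
    length misses the outer quarter on the other side. *)
Lemma avoid_ball (R : realType) (a b x d : R) : a < b -> d < (b - a) / 4 ->
  exists a' b', [/\ a <= a', a' < b', b' <= b &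
    forall y, `|y - x| <= d -> ~~ (a' <= y <= b')].
Proof.
move=> ab dab; have [xm|xm] := lerP x ((a + b) / 2).
  exists (b - (b - a) / 4), b; split; [lra|lra|lra|].
  by move=> y; rewrite ler_norml => yx; apply/negP => yab; lra.
exists a, (a + (b - a) / 4); split; [lra|lra|lra|].
by move=> y; rewrite ler_norml => yx; apply/negP => yab; lra.
Qed.

Lemma exp_half_lt (R : realType) (d : R) : 0 < d -> exists m, 2^-1 ^+ m < d.
Proof.
move=> d0; have /cvgrPdist_lt/(_ d d0)[m _ /(_ m (leqnn m))] :
    (fun n => (2^-1 : R) ^+ n) @ \oo --> (0 : R).
  by apply: cvg_expr; rewrite ger0_norm ?invr_ge0// invf_lt1// ltr1n.
by rewrite /= sub0r normrN ger0_norm ?exprn_ge0 ?invr_ge0// => md; exists m.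
Qed.

Lemma avoid_real_answer (R : realType) c q e N (a b : R) : a < b ->
  follows e N (in_itv_codes a b) e ->
  exists e' M a' b', [/\ (N < M)%N, a' < b' & a <= a' /\ b' <= b] /\
    [/\ follows e N (in_itv_codes a b) e', follows e' M (in_itv_codes a' b') e' &
      forall e'' r y, follows e' M (in_itv_codes a' b') e'' ->
        (forall m, eval (bpair (const_names e'') q) c m (r m)) ->
        real_rep R r y -> ~~ (a' <= y <= b')].
Proof.
(* Entry [m] of the output locates the real answer so precisely that [avoid_ball] applies to it. *)
move=> ab eP; have [|m mab] := @exp_half_lt R ((b - a) / 4); first by lra.
have [no|[e1 [M [v [e1P ev]]]]] := force_output c q m e N (in_itv_codes a b).
  (* Here no output can occur, and the condition is kept; [N] still grows by one, as fusion asks for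
     a strictly increasing sequence of lengths. *)
  have eP' : follows e N.+1 (in_itv_codes a b) e.
    by split=> // k /ltnW; exact: eP.2.
  exists e, N.+1, a, b; split=> //; split=> // e'' r y e''P /(_ m) ev.
  by case: (no e'' (r m) _ ev); exact: (follows_trans (leqnSn N) _ eP e''P).
have [a' [b' [aa' ab' bb' avoid]]] := avoid_ball (rat_val R v) ab mab.
have [w wP] := rat_val_dense ab'.
have sub : in_itv_codes a' b' `<=` in_itv_codes a b.
  by move=> k /andP[a'k kb'] /=; apply/andP; split; lra.
have NM := leq_maxl N.+1 M.
have e'P : follows e N (in_itv_codes a b)
    (fun k => if (k < maxn N.+1 M)%N then e1 k else w).
  by apply: follows_tail => //; [exact: ltnW|exact: sub].
exists (fun k => if (k < maxn N.+1 M)%N then e1 k else w), (maxn N.+1 M), a', b'.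
split=> //; split=> //.
  by split=> // k; rewrite leqNgt => /negbTE ->.
move=> e'' r y e''P /(_ m) evr /real_repP/(_ m) ry; apply: avoid.
suff -> : v = r m by [].
apply: eval_functional evr; apply: ev => k kM.
have kNM := leq_trans kM (leq_maxr N.+1 M).
by rewrite -e''P.1 ?kNM.
Qed.

Lemma avoid_real_answers (R : realType) c (q : nat -> baire) :
  exists (e N : nat -> nat) (a b : nat -> R),
  (forall j k, (N j <= k)%N -> a j <= rat_val R (e k) <= b j) /\
  (forall k, 0 <= rat_val R (e k) <= 1) /\
  forall j r y, (forall m, eval (bpair (const_names e) (q j)) c m (r m)) ->
    real_rep R r y -> ~~ (a j <= y <= b j).
Proof.
pose state : Type := ((nat -> nat) * nat) * (R * R).
pose codes (s : state) := in_itv_codes s.2.1 s.2.2.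
pose valid (s : state) := s.2.1 < s.2.2 /\ follows s.1.1 s.1.2 (codes s) s.1.1.
pose step j (s t : state) := [/\ (s.1.2 < t.1.2)%N, codes t `<=` codes s,
  follows s.1.1 s.1.2 (codes s) t.1.1 &
  forall e r y, follows t.1.1 t.1.2 (codes t) e ->
    (forall m, eval (bpair (const_names e) (q j)) c m (r m)) ->
    real_rep R r y -> ~~ (t.2.1 <= y <= t.2.2)].
(* Choice turns the one-answer step into a function on all states; on invalid states the requirement
   is vacuous and the state is returned unchanged. *)
have [next nextP] : {next : nat * state -> state &
    forall js, valid js.2 -> valid (next js) /\ step js.1 js.2 (next js)}.
  apply: (@choice _ _ (fun js t => valid js.2 -> valid t /\ step js.1 js.2 t)).
  move=> [j [[e N] [a b]]].
  have [[/= ab eP]|nv] := pselect (valid ((e, N), (a, b))); last first.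
    by exists ((e, N), (a, b)).
  have [e' [M [a' [b' [[NM ab' [aa' bb']] [eP' e'P avoid]]]]]] :=
    avoid_real_answer c (q j) ab eP.
  exists ((e', M), (a', b')) => _; split; split=> //.
  by move=> k /andP[a'k kb']; apply/andP; split;
    [exact: le_trans aa' a'k|exact: le_trans kb' bb'].
have [w wP] := @rat_val_dense R 0 1 ltr01.
pose f j : state :=
  nat_rect (fun=> state) (((fun=> w), 0%N), (0, 1)) (fun j s => next (j, s)) j.
have validf j : valid (f j).
  elim: j => [|j IHj]; first by split=> //=; exact: ltr01.
  by have [] := nextP (j, f j) IHj.
have stepf j : step j (f j) (f j.+1) by have [] := nextP (j, f j) (validf j).
have [j|j|j|j|e eP] := @fusion (fun j => (f j).1.1) (fun j => (f j).1.2)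
  (fun j => codes (f j)).
- by have [] := stepf j.
- by have [] := stepf j.
- exact: (validf j).2.
- by have [] := stepf j.
(* Answer [j] is dealt with in passing from stage [j] to stage [j.+1], hence the shift. *)
exists e, (fun j => (f j.+1).1.2), (fun j => (f j.+1).2.1), (fun j => (f j.+1).2.2).
split=> [j k|]; first exact: (eP j.+1).2.
split=> [k|j r y ev ry]; first exact: (eP 0%N).2.
by have [_ _ _] := stepf j; apply; [exact: eP|exact: ev|exact: ry].
Qed.

(** Whichever [j] is the answer, the tail from [N j] on keeps every cluster point inside
    [[a j, b j]], while the real computed from [j] lies outside. *)
Lemma BWT_real_nle_nat (R : realType) : ~ BWT_real R <=W BWT_nat.
Proof.
move=> /(@weihrauch_le_code _ BWT_nat (fun (y : nat) _ => y)).
move=> /(_ (fun=> erefl))[c cP].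
have [e [N [a [b [eN [e01 avoid]]]]]] := avoid_real_answers R c (fun j _ => j).
pose x k : R^o := rat_numbering R (e k).
have px : seq_rep (real_rep R) (const_names e) x.
  rewrite seq_repE => i; have := real_rep_const R (e i); congr (rep _ _ _).
  by apply/funext => j; rewrite /const_names cpairK.
have [|j [r [y [ev ry [_ xy]]]]] := cP _ _ px.
  apply/BWT_domE; apply: (@subclosed_compact _ _ [set` `[0 : R, 1]]).
  - exact: closed_closure.
  - exact: segment_compact.
  - rewrite closureE; apply: smallest_sub; first exact: interval_closed.
    by move=> _ [k _ <-]; rewrite /= in_itv /=; exact: e01.
have /negP := avoid _ _ _ ev ry; apply.
suff : [set` `[a j, b j]] y by rewrite /= in_itv.
have : closure (x @` [set k | (N j <= k)%N]) y.
  move: xy; rewrite clusterE; apply.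
  by exists (N j) => // k Nk; exists k.
rewrite closureE; apply; split; first exact: interval_closed.
by move=> _ [k Nk <-]; rewrite /= in_itv /=; exact: eN.
Qed.

Theorem theorem13p4 (R : realType) (n : nat) :
  BWT_ord n <W BWT_ord n.+1 /\
  BWT_ord n.+1 <W BWT_nat /\
  BWT_nat <W BWT_real R.
Proof.
split; [|split]; split.
- exact: BWT_ord_le_ordS.
- apply: (@BWT_nle_ord (discrete_topology 'I_n.+1) _ n (@nat_of_ord n.+1)) => // w wn.
  by exists (Ordinal (wn : (w < n.+1)%N)).
- exact: BWT_ord_le_nat.
(* Here [n.+1] answers face the [n.+2] values [0, ..., n.+1], all available in [nat]. *)
- by apply: (@BWT_nle_ord nat _ n.+1 id) => // w _; exists w.
- exact: BWT_nat_le_real.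
- exact: BWT_real_nle_nat.
Qed.
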